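(* Let a $C^0$ flow on a generalized Peano continuum $M$ be given. Endowed with the Hausdorff metric $d_H$, $H\mathcal{S}$ is (1) locally a Peano continuum, i.e. every neighbourhood in $H\mathcal{S}$ of each $\Lambda\in H\mathcal{S}$ contains a neighbourhood of $\Lambda$ in $H\mathcal{S}$ that is a Peano continuum; (2) the union of countably many disjoint generalized Peano continua, each clopen in $H\mathcal{S}$.
   Context: A generalized Peano continuum is a locally compact, connected and locally connected metric space; a Peano continuum is a compact one. A $C^0$ flow on $M$ is a continuous action of $(\mathbb{R},+)$ on $M$. A minimal set is a nonempty closed invariant set containing no smaller nonempty closed invariant set. $\mathrm{CMin}$ is the set of all compact minimal sets of the flow, endowed with the Hausdorff metric $d_H$. A neighbourhood of a set $Y\subset M$ is a set whose interior contains $Y$. A nonempty compact invariant set $K$ is (Lyapunov) stable if every neighbourhood of $K$ contains a positively invariant neighbourhood of $K$; otherwise unstable. $\mathcal{U}$ is the set of unstable compact minimal sets. $\Lambda\in\mathrm{CMin}$ is hyper-stable if some neighbourhood of $\Lambda$ in $M$ intersects no $\Gamma\in\mathcal{U}$; $H\mathcal{S}$ is the set of hyper-stable compact minimal sets (equivalently, the interior in $[\mathrm{CMin},d_H]$ of the set of stable compact minimal sets). ''Countably many'' includes finitely many or none. *)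

(* Defs.v *)
From HB Require Import structures.
From mathcomp Require Import all_boot all_order all_algebra.
From mathcomp Require Import all_classical all_reals all_analysis.

Set Implicit Arguments.
Unset Strict Implicit.
Unset Printing Implicit Defensive.

Import Order.TTheory GRing.Theory Num.Theory.
Import numFieldTopology.Exports.

Local Open Scope classical_set_scope.
Local Open Scope ring_scope.

Section subset_metric.
Context {R : realType} {X : metricType R} (A : set X).

Definition sub_mdist (x y : A) : R := mdist (val x) (val y).

Lemma sub_mdist_ge0 x y : 0 <= sub_mdist x y.
Proof. exact: mdist_ge0. Qed.

Lemma sub_mdist_positivity x y : sub_mdist x y = 0 -> x = y.
Proof. by move/mdist_positivity/val_inj. Qed.

Lemma sub_ballEmdist (x : A) d : ball x d = [set y | sub_mdist x y < d].
Proof.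
have -> : ball x d = val @^-1` (ball (val x) d) by [].
by rewrite ballEmdist.
Qed.

(* The restricted metric on a subset, compatible with the library's initial
   topology and uniformity on [set_type A]. *)
HB.instance Definition _ := PseudoMetric_isMetric.Build R (set_type A)
  sub_mdist_ge0 sub_mdist_positivity sub_ballEmdist.

End subset_metric.

Record hyperspace (R : realType) (M : metricType R) := Hyperspace {
  carrier :> set M ;
  carrier_nonempty : carrier !=set0 ;
  carrier_compact : compact carrier }.

Section hausdorff_metric.
Context {R : realType} {M : metricType R}.
Implicit Types (A B C : set M) (K L N : hyperspace M).

(* The infimum of these radii is the Hausdorff distance; for nonempty bounded
   sets it equals max(sup_{x in A} d(x, B), sup_{y in B} d(y, A)). *)
Definition hausdorff_radii A B : set R :=
  [set r | [/\ 0 < r, (forall x, A x -> exists2 y, B y & mdist x y < r)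
     & (forall y, B y -> exists2 x, A x & mdist x y < r)]].

Definition hausdorff_dist K L : R := inf (hausdorff_radii K L).

Lemma hausdorff_radii_lb A B : lbound (hausdorff_radii A B) 0.
Proof. by move=> r [/ltW]. Qed.

Lemma compact_mdist_bounded (x : M) A : compact A ->
  exists2 r : R, 0 < r & forall y, A y -> mdist x y < r.
Proof.
move/compact_near_coveringP/(_ R +oo (fun r y => mdist x y < r)) => near_A.
have: \forall r \near (+oo : set_system R), A `<=` [set y | mdist x y < r].
  apply: near_A => y _.
  exists (ball y 1, [set r | mdist x y + 1 < r]) => /=.
    by split; [exact: nbhsx_ballx|apply: nbhs_pinfty_gt; exact: num_real].
  move=> [z r]/= []; rewrite ballEmdist/= => yz; apply: le_lt_trans.
  by rewrite (le_trans (metric_triangle x y z))// lerD2l ltW.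
move=> Ar.
have r_gt0 : \forall r \near (+oo : set_system R), 0 < r.
  by apply: nbhs_pinfty_gt; exact: num_real.
have [r [Ar' r0]] := filter_ex (filterI Ar r_gt0).
by exists r.
Qed.

Lemma hausdorff_radii_nonempty K L : hausdorff_radii K L !=set0.
Proof.
have [k Kk] := carrier_nonempty K; have [l Ll] := carrier_nonempty L.
have [r r0 lK] := compact_mdist_bounded l (@carrier_compact _ _ K).
have [s s0 kL] := compact_mdist_bounded k (@carrier_compact _ _ L).
exists (r + s); split; first exact: addr_gt0.
- move=> x /lK lx; exists l => //.
  by rewrite metric_sym (lt_le_trans lx)// lerDl ltW.
- move=> y /kL ky; exists k => //.
  by rewrite (lt_le_trans ky)// lerDr ltW.
Qed.

Lemma hausdorff_radii_lt K L e : hausdorff_dist K L < e ->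
  exists2 r, hausdorff_radii K L r & r < e.
Proof. by apply: inf_lt; exact: hausdorff_radii_nonempty. Qed.

Lemma hausdorff_dist_le K L r :
  hausdorff_radii K L r -> hausdorff_dist K L <= r.
Proof. by apply: ge_inf; exists 0; exact: hausdorff_radii_lb. Qed.

Lemma hausdorff_dist_ge0 K L : 0 <= hausdorff_dist K L.
Proof.
apply: lb_le_inf; [exact: hausdorff_radii_nonempty|exact: hausdorff_radii_lb].
Qed.

Lemma hausdorff_distxx K : hausdorff_dist K K = 0.
Proof.
apply/eqP; rewrite eq_le hausdorff_dist_ge0 andbT.
apply/ler_addgt0Pl => e e0; rewrite addr0; apply: hausdorff_dist_le.
by split=> // x Kx; exists x => //; rewrite mdistxx.
Qed.

Lemma hausdorff_radiiC A B : hausdorff_radii A B `<=` hausdorff_radii B A.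
Proof.
move=> r [r0 AB BA]; split=> // x.
- by move=> /BA[y Ay xy]; exists y => //; rewrite metric_sym.
- by move=> /AB[y By xy]; exists y => //; rewrite metric_sym.
Qed.

Lemma hausdorff_dist_sym K L : hausdorff_dist K L = hausdorff_dist L K.
Proof.
by congr inf; rewrite eqEsubset; split; exact: hausdorff_radiiC.
Qed.

Lemma hausdorff_dist_triangle L K N :
  hausdorff_dist K N <= hausdorff_dist K L + hausdorff_dist L N.
Proof.
apply/ler_addgt0Pl => e e0.
have e20 : 0 < e / 2 by rewrite divr_gt0.
have [|r [r0 KL LK] rlt] := @hausdorff_radii_lt K L (hausdorff_dist K L + e / 2).
  by rewrite ltrDl.
have [|s [s0 LN NL] slt] := @hausdorff_radii_lt L N (hausdorff_dist L N + e / 2).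
  by rewrite ltrDl.
apply: (@le_trans _ _ (r + s)); last first.
  have := lerD (ltW rlt) (ltW slt).
  by rewrite addrACA -splitr [leRHS]addrC.
apply: hausdorff_dist_le; split; first exact: addr_gt0.
- move=> x /KL[y Ly xy]; have [z Nz yz] := LN _ Ly; exists z => //.
  by rewrite (le_lt_trans (metric_triangle _ y _))// ltrD.
- move=> z /NL[y Ly yz]; have [x Kx xy] := LK _ Ly; exists x => //.
  by rewrite (le_lt_trans (metric_triangle _ y _))// ltrD.
Qed.

Lemma hausdorff_dist0_sub K L : hausdorff_dist K L = 0 -> K `<=` L.
Proof.
move=> KL0 x Kx.
have cL : closed L.
  by apply: compact_closed; [exact: metric_hausdorff|exact: carrier_compact].
rewrite (closure_id L).1// => U; rewrite -nbhs_ballE => -[e /= e0 xeU].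
have [|r [_ + _] re] := @hausdorff_radii_lt K L e; first by rewrite KL0.
move=> /(_ _ Kx)[y Ly xy]; exists y; split => //; apply: xeU.
by rewrite ballEmdist/= (lt_trans xy).
Qed.

Lemma hausdorff_dist_positivity K L : hausdorff_dist K L = 0 -> K = L.
Proof.
move=> KL0; have KL : carrier K = carrier L.
  rewrite eqEsubset; split; apply: hausdorff_dist0_sub => //.
  by rewrite hausdorff_dist_sym.
case: K L KL {KL0} => [A A0 cA] [B B0 cB] /= AB; subst B.
by rewrite (Prop_irrelevance A0 B0) (Prop_irrelevance cA cB).
Qed.

HB.instance Definition _ := gen_eqMixin (hyperspace M).
HB.instance Definition _ := gen_choiceMixin (hyperspace M).
HB.instance Definition _ := isMetric.Build R (hyperspace M)
  hausdorff_distxx hausdorff_dist_positivity hausdorff_dist_sym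
  hausdorff_dist_triangle.

End hausdorff_metric.

Definition locally_connected (T : topologicalType) :=
  forall (x : T) (U : set T), nbhs x U ->
    exists V : set T, [/\ open V, V x, connected V & V `<=` U].

(* As for the library's [connected], the empty space is allowed. *)
Definition generalized_peano_continuum (R : realType) (T : metricType R) :=
  [/\ locally_compact [set: T], connected [set: T] & locally_connected T].

Definition peano_continuum (R : realType) (T : metricType R) :=
  generalized_peano_continuum T /\ compact [set: T].

Definition locally_peano_continuum (R : realType) (T : metricType R) :=
  forall (x : T) (V : set T), nbhs x V ->
    exists W : set T, [/\ nbhs x W, W `<=` V & peano_continuum (set_type W)].

Section flow.
Context {R : realType} {M : metricType R}.
Implicit Types (phi : R -> M -> M) (A V K : set M).

Definition C0_flow phi :=
  [/\ continuous (fun p : R * M => phi p.1 p.2),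
      forall x, phi 0 x = x
    & forall s t x, phi (s + t) x = phi s (phi t x)].

Definition invariant phi A := forall t x, A x -> A (phi t x).

Definition positively_invariant phi A :=
  forall t x, 0 <= t -> A x -> A (phi t x).

Definition minimal_set phi A :=
  [/\ A !=set0, closed A, invariant phi A
    & forall B, B !=set0 -> closed B -> invariant phi B -> B `<=` A -> B = A].

Definition neighbourhood A V := A `<=` V°.

Definition stable phi K := forall V, neighbourhood K V ->
  exists W, [/\ neighbourhood K W, positively_invariant phi W & W `<=` V].

Definition CMin phi : set (hyperspace M) :=
  [set K : hyperspace M | minimal_set phi K].

Definition unstable_CMin phi : set (hyperspace M) :=
  CMin phi `&` [set K : hyperspace M | ~ stable phi K].

(* As a type, [HS phi] carries the restriction of the Hausdorff metric. *)
Definition HS phi : set (hyperspace M) :=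
  CMin phi `&` [set L : hyperspace M | exists2 V : set M, neighbourhood L V &
    forall K : hyperspace M, unstable_CMin phi K -> V `&` K = set0].

End flow.

(* Main.v *)
From mathcomp Require Import all_boot all_order all_algebra.
From mathcomp Require Import all_classical all_reals all_analysis.
From mathcomp Require Import lra.
Require Import Defs.

(** Why the theorem holds.

    Write x ~> G when the compact minimal set G lies in the closure of the
    forward orbit of x.  For a stable G the relation is rigid: a point which is
    sent close to G stays close to G, and an invariant set that comes close to
    one point of G comes close to all of G, because every orbit of G is dense
    in G.  Hence, if x ~> G with G stable, then all minimal sets attracting
    points near x are Hausdorff-close to G ([attracted_continuous]); in
    particular G is determined by x.  If G is hyper-stable, then every point of
    some neighbourhood of G has a precompact forward orbit trapped where no
    unstable minimal set lives, so that it is attracted by some hyper-stable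
    set ([HS_attracts_neighbourhood]); the existence of a minimal set in a
    compact orbit closure is Zorn's lemma.

    The points attracted by hyper-stable sets thus form an open subset of M, the
    basin, and sending x to its attractor is a continuous map f from the basin
    onto HS.  This map need not be open, but every G in HS has preimages at
    which f carries neighbourhoods to neighbourhoods, namely the points x of G:
    a minimal set close to G has a point close to x, and f maps that point to
    this minimal set ([exists_attractor_map]).  Such a map transports local
    compactness and local connectedness from M to HS ([locally_compact_image],
    [locally_connected_image]).  The rest is topology of a metric space T = HS
    with these two properties.

    For (1), a point of T has arbitrarily small Peano neighbourhoods.  The
    closure of a connected open neighbourhood need not be locally connected, but
    it is as soon as the neighbourhood has property S: it is a finite union of
    connected sets of diameter at most e, for every e > 0.  Neighbourhoods with
    property S are obtained as the sets of points reached from x by chains of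
    connected sets of geometrically decreasing diameters ([chain_ball]).

    For (2), the components of the locally connected space T are clopen.  They
    are countably many because their preimages by f are disjoint nonempty open
    subsets of M, and M, being connected and locally compact, is separable
    ([connected_countably_ball_covered]). *)

Set Implicit Arguments.
Unset Strict Implicit.
Unset Printing Implicit Defensive.

Import Order.TTheory GRing.Theory Num.Theory.
Import numFieldTopology.Exports.

Local Open Scope classical_set_scope.
Local Open Scope ring_scope.

(** * Metric, compact and locally connected spaces *)

Lemma nbhs_mdistP (R : realType) (T : metricType R) (x : T) (U : set T) :
  nbhs x U <-> exists2 e : R, 0 < e & forall y, mdist x y < e -> U y.
Proof.
rewrite -nbhs_ballE; split=> -[e e0 eU]; exists e => //.
  by move=> y xy; apply: eU; rewrite ballEmdist.
by move=> y; rewrite ballEmdist => /eU.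
Qed.

Lemma nbhs_mdist_lt (R : realType) (T : metricType R) (x : T) (e : R) :
  0 < e -> \forall y \near x, mdist x y < e.
Proof. by move=> e0; apply/nbhs_mdistP; exists e. Qed.

Lemma closed_mdist_le (R : realType) (T : metricType R) (x : T) (r : R) :
  closed [set y | mdist x y <= r].
Proof.
move=> y cly /=; apply/ler_addgt0Pl => e e0.
have [z [/= xz yz]] := cly _ (nbhs_mdist_lt y e0).
have := metric_triangle x z y; rewrite (metric_sym z y).
by move: xz yz; clear; lra.
Qed.

Lemma locally_compactP (T : topologicalType) : locally_compact [set: T] <->
  forall x : T, exists K, [/\ nbhs x K, compact K & closed K].
Proof.
split=> lcT x.
  by have [K] := lcT x I; rewrite withinET => xK [cK clK]; exists K.
by have [K [xK cK clK]] := lcT x; exists K; rewrite ?withinET.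
Qed.

(** Finite subcovers as an induction principle: each use below is a property of
    sets that is stable under finite unions and subsets and holds near every
    point of K.  The proof applies the near-covering form of compactness to the
    filter of the large sets with property P. *)
Lemma compact_ind (T : topologicalType) (P : set T -> Prop) (K : set T) :
  P set0 -> (forall A B, P A -> P B -> P (A `|` B)) ->
  (forall A B, A `<=` B -> P B -> P A) ->
  compact K -> (forall x, K x -> exists2 U, nbhs x U & P U) -> P K.
Proof.
move=> P0 PU PS /compact_near_coveringP cK locP.
pose F := filter_from P (fun A => [set B | P B /\ A `<=` B]).
have FF : ProperFilter F.
  apply: filter_from_proper => [|A PA]; last by exists A; split.
  apply: filter_from_filter; first by exists set0.
  move=> A B PA PB; exists (A `|` B); first exact: PU.
  by move=> C [PC]; rewrite subUset => -[].
have /filter_ex[B [PB KB]] : \forall B \near F, P B /\ K `<=` B.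
  apply: filterI; first by exists set0 => // A [].
  apply: (cK _ F (fun B x => B x)) => x /locP[U xU PU'].
  exists (U, [set B | P B /\ U `<=` B]); first by split=> //; exists U.
  by move=> [y B] /= [Uy [_]]; exact.
exact: PS PB.
Qed.

Lemma locally_compact_nbhs (R : realType) (T : metricType R) (x : T)
    (U : set T) : locally_compact [set: T] -> nbhs x U ->
  exists C, [/\ nbhs x C, compact C, closed C & C `<=` U].
Proof.
move=> /locally_compactP/(_ x)[K [xK cK clK]] /nbhs_mdistP[e e0 eU].
have clKe : closed (K `&` [set y | mdist x y <= e / 2]).
  by apply: closedI => //; exact: closed_mdist_le.
exists (K `&` [set y | mdist x y <= e / 2]); split=> //.
- apply: filterI => //; apply/nbhs_mdistP; exists (e / 2) => [|y /ltW//].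
  by rewrite divr_gt0.
- by apply: (subclosed_compact _ cK) => //; exact: subIsetl.
- by move=> y [_ /= xy]; apply: eU; move: e0 xy; clear; lra.
Qed.

Lemma compact_neighbourhood (R : realType) (T : metricType R) (K U : set T) :
  locally_compact [set: T] -> compact K -> neighbourhood K U ->
  exists C, [/\ neighbourhood K C, compact C, closed C & C `<=` U].
Proof.
move=> lcT cK KU; pattern K; apply: compact_ind cK _.
- by exists set0; split; [by []|exact: compact0|exact: closed0|by []].
- move=> A B [C [AC cC clC CU]] [D [BD cD clD DU]].
  exists (C `|` D); split.
  + rewrite /neighbourhood subUset; split.
      by apply: subset_trans AC _; apply: interiorS; exact: subsetUl.
    by apply: subset_trans BD _; apply: interiorS; exact: subsetUr.
  + exact: compactU.
  + exact: closedU.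
  + by rewrite subUset.
- move=> A B AB [C [BC cC clC CU]]; exists C; split => //.
  exact: subset_trans BC.
- move=> x /KU /(locally_compact_nbhs lcT)[C [xC cC clC CU]].
  by exists C°; [exact: nbhs_interior|exists C; split].
Qed.

Lemma compact_thickening (R : realType) (T : metricType R) (K U : set T) :
  compact K -> neighbourhood K U ->
  exists2 r : R, 0 < r & forall x y, K x -> mdist x y < r -> U y.
Proof.
move=> cK KU; pattern K; apply: compact_ind cK _.
- by exists 1 => // x y [].
- move=> A B [r r0 Ar] [s s0 Bs]; exists (Num.min r s).
    by rewrite lt_min r0.
  move=> x y AB; rewrite lt_min => /andP[xr xs].
  by case: AB => [/Ar|/Bs]; apply.
- by move=> A B AB [r r0 Br]; exists r => // x y /AB; exact: Br.
- move=> x /KU /nbhs_mdistP[e e0 eU].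
  have e20 : 0 < e / 2 by rewrite divr_gt0.
  exists [set y | mdist x y < e / 2]; first exact: nbhs_mdist_lt.
  exists (e / 2) => // y z /= xy yz; apply: eU.
  have := metric_triangle x y z.
  by move: xy yz; clear; lra.
Qed.

Section subspaces.
Context {T : topologicalType} (A : set T).

Lemma nbhs_set_typeP (x : A) (V : set A) : nbhs x V <->
  exists2 U, nbhs (val x) U & forall y : A, U (val y) -> V y.
Proof.
split=> [|[U xU UV]].
  move=> [_ [[Q' oQ' <-] Q'x] QV].
  move: Q'x; rewrite /preimage/= set_valE => Q'x.
  by exists Q'; [apply: open_nbhs_nbhs; split|move=> y; exact: QV].
by apply: (filterS UV); exact: (@initial_continuous A T set_val x U xU).
Qed.

Lemma val_set_type_continuous : continuous (val : A -> T).
Proof. by move=> x U xU; apply/nbhs_set_typeP; exists U. Qed.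

(** Relatively clopen parts of B in the subtype are, seen in T, relatively
    clopen parts of its image. *)
Lemma connected_set_type (B : set A) : connected (val @` B) -> connected B.
Proof.
move=> cB C [x Cx] [D [D' oD' DE] CD] [E cE CE].
have [E' oE' EE] : open (~` E) by exact: closed_openC.
have EE' y : E y <-> ~ E' (val y).
  have -> : E' (val y) = (~` E) y by rewrite -EE.
  by split=> [? /(_ _)//|/contrapT].
have : val @` C = val @` B.
  apply: cB; first by exists (val x), x.
  - exists D' => //.
    rewrite eqEsubset; split=> [_ [y + <-]|_ [[y By <-] D'y]].
      by rewrite CD => -[By]; rewrite -DE => D'y; split => //; exists y.
    by exists y => //; rewrite CD -DE.
  - exists (~` E'); first exact: open_closedC.
    rewrite eqEsubset; split=> [_ [y + <-]|_ [[y By <-] E'y]].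
      by rewrite CE => -[By /EE' Ey]; split => //; exists y.
    by exists y => //; rewrite CE; split=> //; apply/EE'.
move=> CB; rewrite eqEsubset; split=> y; first by rewrite CD => -[].
move=> By; have : (val @` C) (val y) by rewrite CB; exists y.
by move=> [z Cz /val_inj <-].
Qed.

Lemma compact_set_type (B : set A) : compact (val @` B) -> compact B.
Proof.
move=> cB F FF FB.
have FvB (C : set A) : F C -> (val @ F) (val @` C).
  by apply: (@filterS _ F) => z Cz; exists z.
have [_ [[y By <-] yF]] := cB (val @ F) _ (FvB _ FB).
exists y; split=> // C U FC /nbhs_set_typeP[V yV VU].
have [_ [[z Cz <-] Vz]] := yF _ V (FvB _ FC) yV.
by exists z; split => //; exact: VU.
Qed.

Lemma image_val_setT : val @` [set: A] = A.
Proof.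
rewrite eqEsubset; split=> [_ [x _ <-]|x Ax]; first exact: set_valP.
by exists (SigSub (mem_set Ax)).
Qed.

End subspaces.

Section local_connectedness.
Context {T : topologicalType}.

(** Local connectedness with neighbourhoods that need not be open.  At a single
    point it is weaker, but at all points simultaneously it is equivalent, since
    components of open sets are then open. *)
Definition connected_im_kleinen :=
  forall (x : T) (U : set T), nbhs x U ->
    exists C, [/\ nbhs x C, connected C & C `<=` U].

Lemma component_open_im_kleinen (U : set T) (x : T) :
  connected_im_kleinen -> open U -> open (connected_component U x).
Proof.
move=> cik oU; rewrite openE => y [D [Dx DU cD] Dy].
have [|C [yC cC CU]] := cik y U.
  by apply: open_nbhs_nbhs; split=> //; exact: DU.
have Cy := nbhs_singleton yC; apply: filterS yC => z Cz.
exists (D `|` C); last by right.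
split; first by left.
- by rewrite subUset.
- by apply: connectedU => //; exists y; split.
Qed.

Lemma im_kleinen_locally_connected :
  connected_im_kleinen -> locally_connected T.
Proof.
move=> cik x U xU; exists (connected_component U° x); split.
- by apply: component_open_im_kleinen => //; exact: open_interior.
- exact: connected_component_refl.
- exact: component_connected.
- by apply: subset_trans (@interior_subset _ U); exact: connected_component_sub.
Qed.

Lemma locally_connected_im_kleinen :
  locally_connected T -> connected_im_kleinen.
Proof.
move=> lcT x U /lcT[V [oV Vx cV VU]]; exists V; split=> //.
exact: open_nbhs_nbhs.
Qed.

Lemma component_open (U : set T) (x : T) :
  locally_connected T -> open U -> open (connected_component U x).
Proof.
move=> /locally_connected_im_kleinen; exact: component_open_im_kleinen.
Qed.

End local_connectedness.

(** * Peano neighbourhoods *)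

Section property_S.
Context {R : realType} {T : metricType R}.
Implicit Types (A C K L : set T) (x y : T) (r e : R).

Definition diameter_le e A := forall x y, A x -> A y -> mdist x y <= e.

Definition small_connected e A := connected A /\ diameter_le e A.

Definition property_S A := forall e, 0 < e ->
  exists F : set (set T), [/\ finite_set F, A = \bigcup_(C in F) C
    & F `<=` small_connected e].

Lemma diameter_le_closure e A : diameter_le e A -> diameter_le e (closure A).
Proof.
move=> Ae x y clx cly; apply/ler_addgt0Pl => d d0.
have d20 : 0 < d / 2 by rewrite divr_gt0.
have [x' [Ax' xx']] := clx _ (nbhs_mdist_lt x d20).
have [y' [Ay' yy']] := cly _ (nbhs_mdist_lt y d20).
have := metric_triangle x x' y; have := metric_triangle x' y' y.
have := Ae _ _ Ax' Ay'; rewrite (metric_sym y' y) /= in xx' yy' *.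
by lra.
Qed.

Lemma closure_finite_bigcup (F : set (set T)) : finite_set F ->
  closure (\bigcup_(C in F) C) = \bigcup_(C in F) closure C.
Proof.
move=> finF; rewrite eqEsubset; split=> [|x [C FC] Cx]; last first.
  by apply: closureS Cx; exact: bigcup_sup.
have /closure_id -> : closed (\bigcup_(C in F) closure C).
  by apply: closed_bigcup => // C _; exact: closed_closure.
by apply: closureS; apply: subset_bigcup => C _; exact: subset_closure.
Qed.

Lemma property_S_closure A : property_S A -> property_S (closure A).
Proof.
move=> SA e /SA[F [finF -> Fe]]; exists (closure @` F); split.
- exact: finite_image.
- by rewrite closure_finite_bigcup// bigcup_image.
- move=> _ [C /Fe[cC Ce] <-]; split; first exact: connected_closure.
  exact: diameter_le_closure.
Qed.

(** Cover A by finitely many connected sets of diameter at most e / 2.  The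
    closures containing a given point form a connected union, which stays in A
    since A is closed; the other closures, being finitely many, do not
    accumulate at the point. *)
Lemma property_S_locally_connected A :
  closed A -> property_S A -> locally_connected (set_type A).
Proof.
move=> clA SA; apply: im_kleinen_locally_connected => x V.
move=> /nbhs_set_typeP[U /nbhs_mdistP[e e0 eU] UV].
have [|F [finF AF Fe]] := SA (e / 2); first by rewrite divr_gt0.
pose B := \bigcup_(C in F `&` [set C | closure C (val x)]) closure C.
have BA : B `<=` A.
  move=> y [C [FC _] Cy]; rewrite (closure_id A).1// AF.
  by apply: closureS Cy; exact: bigcup_sup.
have valB : val @` ((val : set_type A -> T) @^-1` B) = B.
  rewrite eqEsubset; split=> [_ [y ? <-]//|y By].
  by exists (SigSub (mem_set (BA _ By))).
exists (val @^-1` B); split.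
- apply/nbhs_set_typeP.
  exists (~` \bigcup_(C in F `&` [set C | ~ closure C (val x)]) closure C).
    apply: open_nbhs_nbhs; split; last by move=> [C []].
    apply: closed_openC.
    apply: closed_bigcup => [|C _]; last exact: closed_closure.
    by apply: sub_finite_set finF => C [].
  move=> y yF /=.
  have : A (val y) by exact: set_valP.
  rewrite {1}AF => -[C FC Cy]; exists C; last exact: subset_closure.
  split => //; apply: contrapT => Cx; apply: yF; exists C; first by split.
  exact: subset_closure.
- apply: connected_set_type; rewrite valB.
  apply: bigcup_connected; first by exists (val x) => C [].
  by move=> C [/Fe[cC _] _]; exact: connected_closure.
- move=> y [C [FC Cx] Cy]; apply: UV; apply: eU.
  have [_ /diameter_le_closure Ce] := Fe _ FC.
  have := Ce _ _ Cx Cy.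
  by move: e0; clear; lra.
Qed.

Lemma compact_small_connected_cover K e : 0 < e ->
  locally_connected T -> compact K ->
  exists F : set (set T), [/\ finite_set F, K `<=` \bigcup_(C in F) C
    & F `<=` small_connected e].
Proof.
move=> e0 lcT cK; pattern K; apply: compact_ind cK _.
- by exists set0; split => //; exact: finite_set0.
- move=> A B [F [finF AF Fe]] [G [finG BG Ge]]; exists (F `|` G); split.
  + by rewrite finite_setU.
  + by rewrite bigcup_setU; exact: setUSS.
  + by rewrite subUset.
- move=> A B AB [F [finF BF Fe]]; exists F; split => //.
  exact: subset_trans BF.
- move=> y _.
  have d0 : 0 < e / 2 by rewrite divr_gt0.
  have [C [oC Cy cC CU]] := lcT y _ (nbhs_mdist_lt y d0).
  exists C; first exact: open_nbhs_nbhs.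
  exists [set C]; split; first exact: finite_set1.
    by rewrite bigcup_set1.
  move=> _ ->; split=> // a b /CU/= ya /CU/= yb.
  have := metric_triangle a y b; rewrite (metric_sym a y).
  by move: ya yb; clear; lra.
Qed.

End property_S.

Section chains.
Context {R : realType} {T : metricType R} (x : T) (r : R).
Hypothesis r0 : 0 < r.

(** Points joined to x by a chain of n connected links, the i-th link having
    diameter at most r / 2 ^ i.  The geometric decrease bounds the length of a
    chain by r, and the tail of a chain after k links by r / 2 ^ k. *)
Fixpoint chain_ball_rec n : set T :=
  if n is m.+1 then
    \bigcup_(L in [set L | small_connected (r / 2 ^+ n) L /\
                           L `&` chain_ball_rec m !=set0]) L
  else [set x].

Definition chain_ball := \bigcup_n chain_ball_rec n.

Let radius_gt0 n : 0 < r / 2 ^+ n.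
Proof. by rewrite divr_gt0// exprn_gt0. Qed.

Let radiusS n : r / 2 ^+ n = r / 2 ^+ n.+1 + r / 2 ^+ n.+1.
Proof. by rewrite exprSr invfM mulrA -splitr. Qed.

Lemma chain_ball_recS n : chain_ball_rec n `<=` chain_ball_rec n.+1.
Proof.
move=> y yn; exists [set y] => //; split; last by exists y.
split; first exact: connected1.
by move=> _ _ -> ->; rewrite mdistxx ltW.
Qed.

Lemma chain_ball_rec_center n : chain_ball_rec n x.
Proof. by elim: n => // n /chain_ball_recS. Qed.

Lemma chain_ball_center : chain_ball x.
Proof. by exists 0%N. Qed.

Lemma chain_ball_rec_connected n : connected (chain_ball_rec n).
Proof.
elim: n => [|n IHn]; first exact: connected1.
set D := [set L | small_connected (r / 2 ^+ n.+1) L /\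
                           L `&` chain_ball_rec n !=set0].
have -> : chain_ball_rec n.+1 = \bigcup_(L in D) (L `|` chain_ball_rec n).
  rewrite eqEsubset; split=> y; first by move=> [L DL Ly]; exists L => //; left.
  by move=> [L DL [Ly|/chain_ball_recS//]]; exists L.
apply: bigcup_connected.
  by exists x => L _; right; exact: chain_ball_rec_center.
by move=> L [[cL _] Ln]; exact: connectedU.
Qed.

Lemma chain_ball_connected : connected chain_ball.
Proof.
apply: bigcup_connected => [|n _]; last exact: chain_ball_rec_connected.
by exists x => n _; exact: chain_ball_rec_center.
Qed.

(** A point at the end of a chain with n links has a connected neighbourhood
    small enough to serve as the next link. *)
Lemma chain_ball_open : locally_connected T -> open chain_ball.
Proof.
move=> lcT; rewrite openE => y [n _ yn].
have d0 : 0 < r / 2 ^+ n.+1 / 2 by rewrite divr_gt0.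
have [C [oC Cy cC CU]] := lcT y _ (nbhs_mdist_lt y d0).
apply: (@filterS _ _ _ C); last exact: open_nbhs_nbhs.
move=> z Cz; exists n.+1 => //; exists C => //; split; last by exists y.
split=> // a b /CU/= ya /CU/= yb.
have := metric_triangle a y b; rewrite (metric_sym a y).
by move: ya yb; clear; lra.
Qed.

(** The connected set C is the union of the links after the k-th one; the bound
    is the sum of their diameters. *)
Lemma chain_ball_tail k m y : chain_ball_rec (k + m) y ->
  exists C, [/\ connected C, C `<=` chain_ball, C y,
    C `&` chain_ball_rec k !=set0
    & forall z, C z -> mdist y z <= r / 2 ^+ k - r / 2 ^+ (k + m)].
Proof.
elim: m y => [|m IHm] y.
  rewrite addn0 => yk; exists [set y]; split => //.
  - exact: connected1.
  - by move=> _ ->; exists k.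
  - by exists y.
  - by move=> _ ->; rewrite mdistxx subrr.
rewrite addnS => -[L [[cL Lr] [z [Lz zk]]] Ly].
have [C [cC CS Cz Ck Cr]] := IHm z zk.
exists (L `|` C); split.
- by apply: connectedU => //; exists z.
- rewrite subUset; split=> // u Lu; exists (k + m).+1 => //.
  by exists L => //; split; [|exists z].
- by left.
- by case: Ck => u [Cu uk]; exists u; split => //; right.
- have rS := radiusS (k + m).
  move=> u [Lu|Cu].
    have := Lr _ _ Ly Lu; have := Cr _ Cz; rewrite mdistxx.
    by move: rS; clear; lra.
  have := Lr _ _ Ly Lz; have := Cr _ Cu; have := metric_triangle y z u.
  by move: rS; clear; lra.
Qed.

Lemma chain_ball_mdist y : chain_ball y -> mdist x y <= r.
Proof.
move=> [n _]; rewrite -[n]add0n => /chain_ball_tail[C [_ _ _ [z [Cz zx]] Cr]].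
move: zx Cr => /= zx; subst z => /(_ _ Cz); rewrite metric_sym expr0 divr1.
by have := radius_gt0 (0 + n); lra.
Qed.

(** Let k be such that tails after k links have length less than e / 5.  Cover K
    by finitely many connected sets E as small as a (k+1)-st link.  Those that
    meet the points reached by k links lie in the chain ball; to each of them
    attach every short connected subset of the chain ball meeting it.  The
    resulting connected sets are still small, are finitely many, and contain
    the tail of every chain. *)
Lemma chain_ball_property_S (K : set T) : locally_connected T ->
  compact K -> chain_ball `<=` K -> property_S chain_ball.
Proof.
move=> lcT cK SK e e0.
have [k ke] : exists k, r / 2 ^+ k < e / 5.
  exists (Num.bound (r / (e / 5))).
  have e50 : 0 < e / 5 by rewrite divr_gt0.
  rewrite ltr_pdivrMr ?exprn_gt0// mulrC -ltr_pdivrMr//.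
  apply: lt_trans (archi_boundP _) _; first by rewrite divr_ge0// ltW.
  by rewrite -natrX ltr_nat ltn_expl.
have [F [finF KF Fsmall]] :=
  compact_small_connected_cover (radius_gt0 k.+1) lcT cK.
pose G := F `&` [set E | E `&` chain_ball_rec k !=set0].
pose P (E C : set T) := [/\ connected C, C `<=` chain_ball, E `&` C !=set0
  & diameter_le (2 * (r / 2 ^+ k)) C].
pose M E := \bigcup_(C in P E) (E `|` C).
exists (M @` G); split.
- by apply: finite_image; apply: sub_finite_set finF => E [].
- rewrite bigcup_image eqEsubset; split=> y.
    move=> Sy; have [n _ yn] := Sy.
    (* the number of links may be increased at will: make it at least k *)
    have : chain_ball_rec (k + n) y.
      by elim: (k) => // j /chain_ball_recS; rewrite addSn.
    move=> /chain_ball_tail[C [cC CS Cy [z [Cz zk]] Cr]].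
    have [E FE Ez] := KF z (SK _ (CS _ Cz)).
    exists E; first by split=> //; exists z.
    exists C; last by right.
    split => //; first by exists z.
    move=> a b /Cr ya /Cr yb.
    have := metric_triangle a y b; rewrite (metric_sym a y).
    by have := radius_gt0 (k + n); move: ya yb; clear; lra.
  move=> [E [FE Ek] [C [_ CS _ _] [Ey|/CS//]]].
  by exists k.+1 => //; exists E => //; split => //; exact: Fsmall.
- move=> _ [E [FE Ek] <-]; have [cE Ee] := Fsmall _ FE.
  have [z [Ez _]] := Ek.
  split.
    apply: bigcup_connected; first by exists z => C _; left.
    by move=> C [cC _ EC _]; exact: connectedU.
  have zM y : M E y -> mdist z y <= (r / 2 ^+ k.+1) + 2 * (r / 2 ^+ k).
    have rk := radius_gt0 k.
    move=> [C [_ _ [w [Ew Cw]] Cr] [Ey|Cy]].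
      by have := Ee _ _ Ez Ey; move: rk; clear; lra.
    have := Ee _ _ Ez Ew; have := Cr _ _ Cw Cy; have := metric_triangle z w y.
    by clear; lra.
  move=> a b /zM za /zM zb.
  have := metric_triangle a z b; rewrite (metric_sym a z).
  by have := radiusS k; move: za zb ke; clear; lra.
Qed.

End chains.

Lemma compact_locally_compact (T : topologicalType) :
  compact [set: T] -> locally_compact [set: T].
Proof.
move=> cT; apply/locally_compactP => x; exists setT.
by split=> //; exact: filterT.
Qed.

Lemma locally_compact_connected_peano (R : realType) (T : metricType R) :
  locally_compact [set: T] -> locally_connected T -> locally_peano_continuum T.
Proof.
move=> /locally_compactP lkT lcT x V /nbhs_mdistP[d d0 dV].
have [K [/nbhs_mdistP[e e0 eK] cK clK]] := lkT x.
pose r := Num.min d e / 2.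
have m0 : 0 < Num.min d e by rewrite lt_min d0.
have r0 : 0 < r by rewrite divr_gt0.
have rde : r < d /\ r < e.
  have : r < Num.min d e by rewrite /r; move: m0; clear; lra.
  by rewrite lt_min => /andP.
pose S := chain_ball x r.
have Sr : closure S `<=` [set y | mdist x y <= r].
  rewrite [X in _ `<=` X](closure_id _).1; last exact: closed_mdist_le.
  by apply: closureS; exact: chain_ball_mdist.
have SK : closure S `<=` K.
  by move=> y /Sr xy; apply: eK; apply: le_lt_trans xy _; case: rde.
have cS : compact (closure S).
  by apply: (subclosed_compact _ cK) => //; exact: closed_closure.
exists (closure S); split.
- apply: (filterS (@subset_closure _ S)); apply: open_nbhs_nbhs; split.
    exact: chain_ball_open.
  exact: chain_ball_center.
- by move=> y /Sr xy; apply: dV; apply: le_lt_trans xy _; case: rde.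
- have cWT : compact [set: set_type (closure S)].
    by apply: compact_set_type; rewrite image_val_setT.
  split=> //; split.
  + exact: compact_locally_compact.
  + apply: connected_set_type; rewrite image_val_setT.
    by apply: connected_closure; exact: chain_ball_connected.
  + apply: property_S_locally_connected; first exact: closed_closure.
    apply: property_S_closure; apply: (chain_ball_property_S r0 lcT cK).
    exact: subset_trans (@subset_closure _ S) SK.
Qed.

Lemma clopen_component (T : topologicalType) (x : T) :
  locally_connected T -> clopen (connected_component [set: T] x).
Proof.
by move=> lcT; split; [apply: component_open => //; exact: openT|
  apply: component_closed; exact: closedT].
Qed.

Lemma clopen_connected_generalized_peano (R : realType) (T : metricType R)
    (C : set T) :
  locally_compact [set: T] -> locally_connected T -> clopen C -> connected C ->
  generalized_peano_continuum (set_type C).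
Proof.
move=> /locally_compactP lkT lcT [oC clC] cC.
have C_nbhs (x : set_type C) : nbhs (val x) C.
  by apply: open_nbhs_nbhs; split => //; exact: set_valP.
have valC (B : set T) : B `<=` C ->
    val @` ((val : set_type C -> T) @^-1` B) = B.
  move=> BC; rewrite eqEsubset; split=> [_ [y ? <-]//|y By].
  by exists (SigSub (mem_set (BC _ By))).
split.
- apply/locally_compactP => x; have [K [xK cK clK]] := lkT (val x).
  exists (val @^-1` (K `&` C)); split.
  + by apply: val_set_type_continuous; exact: filterI.
  + apply: compact_set_type; rewrite valC; last exact: subIsetr.
    by apply: (subclosed_compact _ cK); [exact: closedI|exact: subIsetl].
  + apply: preimage_closed; last exact: closedI.
    by move=> y _; exact: val_set_type_continuous.
- by apply: connected_set_type; rewrite image_val_setT.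
- apply: im_kleinen_locally_connected => x V /nbhs_set_typeP[U xU UV].
  have [Q [oQ Qx cQ QUC]] := lcT (val x) _ (filterI xU (C_nbhs x)).
  exists (val @^-1` Q); split.
  + by apply: val_set_type_continuous; exact: open_nbhs_nbhs.
  + by apply: connected_set_type; rewrite valC// => y /QUC[].
  + by move=> y /QUC[Uy _]; exact: UV.
Qed.

(** * Disjoint open families in connected locally compact spaces *)

Section countable_balls.
Context {R : realType} {M : metricType R}.
Implicit Types A B K : set M.

(** Separability of A as a property that is visibly inherited by subsets and by
    countable unions: the centers need not lie in A. *)
Definition countably_ball_covered A := forall e : R, 0 < e ->
  exists2 D : set M, countable D &
    A `<=` \bigcup_(x in D) [set y | mdist x y < e].

Lemma countably_ball_coveredS A B :
  A `<=` B -> countably_ball_covered B -> countably_ball_covered A.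
Proof.
by move=> AB cB e /cB[D cD BD]; exists D => //; exact: subset_trans BD.
Qed.

Lemma countably_ball_covered_bigcup (I : Type) (D : set I) (A : I -> set M) :
  countable D -> (forall i, D i -> countably_ball_covered (A i)) ->
  countably_ball_covered (\bigcup_(i in D) A i).
Proof.
move=> cD cA e e0.
have /choice[E HE] : forall i, exists E : set M, D i ->
    countable E /\ A i `<=` \bigcup_(x in E) [set y | mdist x y < e].
  move=> i; have [Di|nDi] := pselect (D i); last by exists set0.
  by have [E] := cA i Di e e0; exists E.
exists (\bigcup_(i in D) E i).
  by apply: bigcup_countable => // i /HE[].
move=> y [i Di Ay]; have [_ /(_ _ Ay)[x Ex xy]] := HE i Di.
by exists x => //; exists i.
Qed.

Lemma compact_countably_ball_covered K :
  compact K -> countably_ball_covered K.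
Proof.
move=> cK e e0; pattern K; apply: compact_ind cK _.
- by exists set0 => //; exact: countable0.
- move=> A B [D cD AD] [E cE BE]; exists (\bigcup_b if b then D else E).
    by apply: bigcup_countable => [|[] _ //]; exact: countableP.
  move=> y [/AD|/BE] [x Dx xy]; exists x => //; first by exists true.
  by exists false.
- by move=> A B AB [D cD BD]; exists D => //; exact: subset_trans BD.
- move=> x _; exists [set y | mdist x y < e]; first exact: nbhs_mdist_lt.
  by exists [set x]; [exact: countable1|rewrite bigcup_set1].
Qed.

(** Centers can be moved into A at the price of doubling the radius. *)
Lemma countably_ball_covered_centers A (e : R) : countably_ball_covered A ->
  0 < e -> exists D : set M, [/\ countable D, D `<=` A
    & A `<=` \bigcup_(x in D) [set y | mdist x y < e]].
Proof.
move=> cA e0; have [|D cD AD] := cA (e / 2); first by rewrite divr_gt0.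
have /choice[f Hf] : forall x, exists z,
    (exists2 z, A z & mdist x z < e / 2) -> A z /\ mdist x z < e / 2.
  move=> x; have [[z Az xz]|n] := pselect (exists2 z, A z & mdist x z < e / 2).
    by exists z.
  by exists x => /n.
exists (f @` (D `&` [set x | exists2 z, A z & mdist x z < e / 2])); split.
- apply: (@sub_countable _ _ _ D) => //.
  apply: card_le_trans (card_image_le _ _) _.
  by apply: subset_card_le; exact: subIsetl.
- by move=> _ [x [_ /Hf[Afx _]] <-].
- move=> y Ay; have [x Dx /= xy] := AD y Ay.
  have [Ax xf] : A (f x) /\ mdist x (f x) < e / 2 by apply: Hf; exists y.
  exists (f x) => /=; first by exists x => //; split => //; exists y.
  have := metric_triangle (f x) x y; rewrite (metric_sym (f x) x).
  by move: xy xf; clear; lra.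
Qed.

Definition compact_ball (x : M) (r : R) :=
  exists2 K, compact K & forall y, mdist x y < r -> K y.

(** The radius 2r, instead of r, gives room for replacing the center x by a
    nearby point of a countable family. *)
Let enlarge A (r : R) : set M :=
  \bigcup_(x in A `&` [set x | compact_ball x (2 * r)]) [set y | mdist x y < r].

(** The admissible centers form a separable set; let D be a countable r-net of
    them.  A point within r of an admissible center is within 2r of D, so the
    enlargement is covered by countably many compact sets. *)
Lemma countably_ball_covered_enlarge A (r : R) : 0 < r ->
  countably_ball_covered A -> countably_ball_covered (enlarge A r).
Proof.
move=> r0 cA.
have cAr : countably_ball_covered (A `&` [set x | compact_ball x (2 * r)]).
  by apply: countably_ball_coveredS cA; exact: subIsetl.
have [D [cD DA AD]] := countably_ball_covered_centers cAr r0.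
apply: (@countably_ball_coveredS _
    (\bigcup_(d in D) [set y | mdist d y < 2 * r])).
  move=> y [x Ax xy]; have [d Dd dx] := AD _ Ax; exists d => //=.
  have := metric_triangle d x y.
  by move: dx xy => /=; clear; lra.
apply: countably_ball_covered_bigcup => // d /DA[_ [K cK dK]].
by apply: countably_ball_coveredS (compact_countably_ball_covered cK).
Qed.

(** Starting from one point, enlarge repeatedly with all radii 2 ^- k.  Each
    stage is separable, and the union of the stages is open.  It is also closed:
    near a limit point y, balls of a uniform radius are relatively compact, so
    that y itself is reached from a nearby point of the union. *)
Lemma connected_countably_ball_covered :
  locally_compact [set: M] -> connected [set: M] ->
  countably_ball_covered [set: M].
Proof.
move=> /locally_compactP lkM cM.
have [[x0 _]|M0] := pselect ([set: M] !=set0); last first.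
  by move=> e e0; exists set0 => // x _; exfalso; apply: M0; exists x.
pose rad k : R := 2^-1 ^+ k.
have rad0 k : 0 < rad k by rewrite exprn_gt0// invr_gt0.
have rad_small (e : R) : 0 < e -> exists k, rad k < e.
  move=> e0; exists (Num.bound e^-1).
  rewrite /rad exprVn invf_plt ?posrE ?exprn_gt0//.
  apply: lt_trans (archi_boundP _) _; first by rewrite invr_ge0 ltW.
  by rewrite -natrX ltr_nat ltn_expl.
pose G := fix G n := if n is m.+1 then \bigcup_k enlarge (G m) (rad k)
                     else [set x0].
have cG n : countably_ball_covered (G n).
  elim: n => [|n IHn] /=.
    by apply: compact_countably_ball_covered; exact: compact_set1.
  apply: countably_ball_covered_bigcup => [|k _]; first exact: countableP.
  exact: countably_ball_covered_enlarge.
have compact_rad x : exists2 e : R, 0 < e & forall y (r : R),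
    mdist x y + r < e -> compact_ball y r.
  have [K [/nbhs_mdistP[e e0 eK] cK _]] := lkM x; exists e => // y r xyr.
  exists K => // z yz; apply: eK; have := metric_triangle x y z.
  by move: xyr yz; clear; lra.
have <- : \bigcup_n G n = [set: M].
  apply: cM; first by exists x0; exists 0%N.
  - exists (\bigcup_n G n); last by rewrite setTI.
    rewrite openE => x [n _ Gx]; have [e e0 eC] := compact_rad x.
    have [|k ke] := rad_small (e / 2); first by rewrite divr_gt0.
    apply: filterS (nbhs_mdist_lt x (rad0 k)) => y xy.
    exists n.+1 => //; exists k => //; exists x => //; split=> //.
    by apply: eC; rewrite mdistxx; move: ke; clear; lra.
  - exists (\bigcup_n G n); last by rewrite setTI.
    move=> y Gy; have [e e0 eC] := compact_rad y.
    have [|k ke] := rad_small (e / 3); first by rewrite divr_gt0.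
    have [x [[n _ Gx] /= yx]] := Gy _ (nbhs_mdist_lt y (rad0 k)).
    exists n.+1 => //; exists k => //; exists x; last by rewrite /= metric_sym.
    by split=> //; apply: eC; move: ke yx; clear; lra.
apply: countably_ball_covered_bigcup => //; exact: countableP.
Qed.

(** The balls of radii 1 / (n+1) provide a countable dense set, and each of its
    points lies in at most one of the disjoint open sets. *)
Lemma disjoint_open_countable (I : Type) (F : set I) (V : I -> set M) :
  countably_ball_covered [set: M] ->
  (forall i, F i -> open (V i) /\ V i !=set0) ->
  (forall i j, F i -> F j -> V i `&` V j !=set0 -> i = j) ->
  countable F.
Proof.
move=> cM oV dV.
have /choice[D HD] : forall n, exists D : set M, countable D /\
    forall y, exists2 x, D x & mdist x y < n.+1%:R^-1 :> R.
  move=> n; have [|D cD MD] := cM n.+1%:R^-1; first by rewrite invr_gt0.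
  by exists D; split => // y; exact: MD.
pose E := \bigcup_n D n.
have cE : countable E by apply: bigcup_countable => // n _; case: (HD n).
apply: (@sub_countable _ _ _ (\bigcup_(e in E) (F `&` [set i | V i e]))).
  apply: subset_card_le => i Fi; have [oVi [x Vx]] := oV i Fi.
  have /nbhs_mdistP[d d0 dV'] : nbhs x (V i) by exact: open_nbhs_nbhs.
  have [n nd] : exists n, n.+1%:R^-1 < d.
    exists (Num.bound d^-1).
    rewrite invf_plt ?posrE// (lt_trans (archi_boundP _)) ?invr_ge0 ?(ltW d0)//.
    by rewrite ltr_nat.
  have [_ /(_ x)[y Dy yx]] := HD n.
  exists y; first by exists n.
  by split=> //; apply: dV'; rewrite metric_sym (lt_trans yx).
apply: bigcup_countable => // e _.
have [[i [Fi Vi]]|F0] := pselect ((F `&` [set i | V i e]) !=set0); last first.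
  suff -> : F `&` [set i | V i e] = set0 by exact: countable0.
  by rewrite -subset0 => i iF; apply: F0; exists i.
suff -> : F `&` [set i | V i e] = [set i] by exact: countable1.
rewrite eqEsubset; split=> [j [Fj Vj]|_ ->]; last by split.
by apply: dV => //; exists e.
Qed.

End countable_balls.

(** * Attraction towards stable minimal sets *)

Section flow.
Context {R : realType} {M : metricType R} (phi : R -> M -> M).
Hypothesis flow_phi : C0_flow phi.
Implicit Types (x y : M) (t e : R) (A : set M) (G L : hyperspace M).

Let phi0 x : phi 0 x = x. Proof. by case: flow_phi. Qed.

Let phiD s t x : phi (s + t) x = phi s (phi t x).
Proof. by case: flow_phi. Qed.

Let phiK t x : phi (- t) (phi t x) = x.
Proof. by rewrite -phiD addNr phi0. Qed.

Let phiNK t x : phi t (phi (- t) x) = x.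
Proof. by rewrite -phiD subrr phi0. Qed.

Lemma flow_continuous t : continuous (phi t).
Proof.
move=> x; have [cphi _ _] := flow_phi.
by apply: (@continuous2_cvg _ _ _ _ _ _ (fun=> t) id phi);
  [exact: (cphi (t, x))|exact: cvg_cst|exact: cvg_id].
Qed.

Let nbhs_flow t x U : nbhs (phi t x) U -> \forall y \near x, U (phi t y).
Proof. exact: flow_continuous. Qed.

Definition forward_orbit x := [set y | exists2 t, 0 <= t & y = phi t x].

(** For a compact minimal A this amounts to A being contained in the omega-limit
    set of x; when A is moreover stable, it says that this set is A. *)
Definition attracted x A := A `<=` closure (forward_orbit x).

Lemma closure_positively_invariant A :
  positively_invariant phi A -> positively_invariant phi (closure A).
Proof.
move=> pA t x t0 clx U /nbhs_flow /clx[y [Ay Uy]].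
by exists (phi t y); split => //; exact: pA.
Qed.

Lemma forward_orbit_refl x : forward_orbit x x.
Proof. by exists 0; rewrite ?phi0. Qed.

Lemma forward_orbit_positively_invariant x :
  positively_invariant phi (forward_orbit x).
Proof.
move=> t _ t0 [s s0 ->]; exists (t + s); first exact: addr_ge0.
by rewrite phiD.
Qed.

Lemma forward_orbit_sub A x :
  positively_invariant phi A -> A x -> forward_orbit x `<=` A.
Proof. by move=> pA Ax _ [t t0 ->]; exact: pA. Qed.

(** Zorn's lemma yields a minimal nonempty closed positively invariant subset G
    of the orbit closure K; it is phrased with open sets B and G = K \ B, so
    that chains have unions.  Such a G is invariant for negative times too,
    because phi t maps it onto a nonempty closed positively invariant subset of
    G. *)
Lemma exists_minimal_attracted x : compact (closure (forward_orbit x)) ->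
  exists G : hyperspace M, minimal_set phi G /\ attracted x G.
Proof.
set K := closure _ => cK.
have Kx : K x by apply: subset_closure; exact: forward_orbit_refl.
have pK : positively_invariant phi K.
  apply: closure_positively_invariant.
  exact: forward_orbit_positively_invariant.
pose P (B : set M) := [/\ open B, positively_invariant phi (~` B)
  & K `&` ~` B !=set0].
have [F FP totF|B [[oB pB [y KBy]] Bmax]] := @Zorn_bigcup M P.
  split.
  - by apply: bigcup_open => X /FP[].
  - move=> t y t0 Fy [X FX Xy]; have [_ pX _] := FP _ FX.
    by apply: (pX _ _ t0) Xy => Xy; apply: Fy; exists X.
  - apply: contrapT => KF.
    (* an open cover of a nonempty K by a chain has a one-element subcover *)
    have : K `<=` set0 \/ exists2 X, F X & K `<=` X.
      pattern K; apply: compact_ind cK _; first by left.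
      - move=> A B [A0|[X FX AX]] [B0|[Y FY BY]].
        + by left; rewrite subUset.
        + by right; exists Y => //; rewrite subUset; split => // z /A0.
        + by right; exists X => //; rewrite subUset; split => // z /B0.
        + right; have [XY|YX] := totF _ _ FX FY.
            exists Y => //; rewrite subUset; split => //.
            exact: subset_trans XY.
          exists X => //; rewrite subUset; split => //.
          exact: subset_trans YX.
      - move=> A B AB [B0|[X FX BX]]; first by left; exact: subset_trans B0.
        by right; exists X => //; exact: subset_trans BX.
      - move=> z Kz; have [X FX Xz] : (\bigcup_(X in F) X) z.
          by apply: contrapT => Fz; apply: KF; exists z.
        exists X; last by right; exists X.
        by apply: open_nbhs_nbhs; split => //; case: (FP _ FX).
    move=> [/(_ _ Kx)//|[X /FP[_ _ [z [Kz Xz]]] /(_ _ Kz)//]].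
have clB : closed (~` B) by exact: open_closedC.
pose G := K `&` ~` B.
have clG : closed G by apply: closedI => //; exact: closed_closure.
have pG : positively_invariant phi G.
  by move=> t z t0 [Kz Bz]; split; [exact: pK|exact: pB].
have minG C : closed C -> positively_invariant phi C -> C !=set0 ->
    C `<=` G -> C = G.
  move=> clC pC [z Cz] CG; rewrite eqEsubset; split=> // w [Kw Bw].
  apply: contrapT => Cw; apply: (Bmax (~` C)).
    split; last by move=> /(_ w Cw).
    by move=> u Bu /CG[_]; exact.
  split; first exact: closed_openC.
    by rewrite setCK.
  by rewrite setCK; exists z; split => //; case: (CG _ Cz).
have iG : invariant phi G.
  have pGN t z : 0 <= t -> G z -> G (phi (- t) z).
    move=> t0; suff {1}<- : [set z | G (phi (- t) z)] = G by [].
    apply: minG.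
    - apply: (@preimage_closed _ _ (phi (- t))) => // u _.
      exact: flow_continuous.
    - move=> s u s0 /= /(pG s _ s0).
      by rewrite -!phiD addrC.
    - by exists (phi t y); rewrite /= phiK.
    - by move=> u /= /(pG t _ t0); rewrite phiNK.
  move=> t z; have [t0|/ltW t0] := leP 0 t; first exact: pG.
  by rewrite -[t]opprK; apply: pGN; rewrite oppr_ge0.
have cG : compact G by apply: (subclosed_compact clG cK); exact: subIsetl.
have G0 : G !=set0 by exists y.
exists (Hyperspace G0 cG); split; last exact: subIsetl.
split=> // C C0 clC iC CG; apply: minG => // t z _; exact: iC.
Qed.

Lemma invariant_positively A : invariant phi A -> positively_invariant phi A.
Proof. by move=> iA t x _; exact: iA. Qed.

(** The forward orbit closure of x is contained in G and contains a minimal set,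
    which can only be G. *)
Lemma minimal_attracted G x : minimal_set phi G -> carrier G x -> attracted x G.
Proof.
move=> [_ clG iG minG] Gx.
have OG : closure (forward_orbit x) `<=` G.
  rewrite [X in _ `<=` X](closure_id G).1//; apply: closureS.
  by apply: forward_orbit_sub => //; exact: invariant_positively.
have [|L [[L0 clL iL _] xL]] := @exists_minimal_attracted x.
  apply: (subclosed_compact _ (@carrier_compact _ _ G)) => //.
  exact: closed_closure.
by rewrite -(minG L) //; exact: subset_trans OG.
Qed.

Lemma attracted_flow x G t : invariant phi G -> attracted x G ->
  attracted (phi t x) G.
Proof.
move=> iG xG y Gy U; rewrite -{1}[y](phiNK t) => /nbhs_flow.
move=> /(xG _ (iG _ _ Gy))[_ [[s s0 ->] Us]].
exists (phi s (phi t x)); split; first by exists s.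
by rewrite -phiD addrC phiD.
Qed.

Lemma flow_attracted x A t : 0 <= t -> attracted (phi t x) A -> attracted x A.
Proof.
move=> t0 xA; apply: subset_trans xA _; apply: closureS => _ [s s0 ->].
by exists (s + t); [exact: addr_ge0|rewrite phiD].
Qed.

Lemma attracted_enters x G W : neighbourhood G W -> attracted x G ->
  exists2 t, 0 <= t & W° (phi t x).
Proof.
move=> GW xG; have [y Gy] := carrier_nonempty G.
have [_ [[t t0 ->] Wt]] := xG y Gy _ (nbhs_interior (GW _ Gy)).
by exists t.
Qed.

(** Orbits in G are dense in G; by compactness of G, finitely many times
    suffice to come within e of every point of G, and this persists for points
    near x. *)
Lemma near_orbit_dense G x e : minimal_set phi G -> carrier G x -> 0 < e ->
  \forall y \near x, forall g, carrier G g -> exists t, mdist g (phi t y) < e.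
Proof.
move=> mG Gx e0.
pose P A := \forall y \near x, forall g, A g -> exists t, mdist g (phi t y) < e.
suff : P (carrier G) by [].
apply: compact_ind (@carrier_compact _ _ G) _; rewrite /P.
- by apply: nearW => y g.
- move=> A B nA nB; near=> y => g [Ag|Bg].
    by move: g Ag; near: y.
  by move: g Bg; near: y.
- by move=> A B AB; apply: filterS => y + g /AB; exact.
- move=> g Gg; have e30 : 0 < e / 3 by rewrite divr_gt0.
  exists [set h | mdist g h < e / 3]; first exact: nbhs_mdist_lt.
  have [_ [[t t0 ->] gt]] := minimal_attracted mG Gx Gg (nbhs_mdist_lt g e30).
  apply: filterS (nbhs_flow (nbhs_mdist_lt (phi t x) e30)) => y /= xy h /= gh.
  exists t; have := metric_triangle h g (phi t y).
  have := metric_triangle g (phi t x) (phi t y); rewrite (metric_sym h g).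
  by move: gt xy gh; rewrite /=; clear; lra.
Unshelve. all: by end_near. Qed.

(** A forward orbit trapped near G has its limits near G.  Conversely an
    invariant set L with a point near G has an orbit passing near every point of
    G by [near_orbit_dense].  These are the two halves of the Hausdorff
    distance. *)
Lemma stable_attracted_near G e : minimal_set phi G -> stable phi G -> 0 < e ->
  exists2 W, neighbourhood G W & forall x L, W x -> minimal_set phi L ->
    attracted x L -> hausdorff_dist G L < e.
Proof.
move=> mG sG e0; have e20 : 0 < e / 2 by rewrite divr_gt0.
pose V := [set x | forall g, carrier G g ->
                     exists t, mdist g (phi t x) < e / 2].
have GV : neighbourhood G V by move=> x Gx; exact: near_orbit_dense.
have [r r0 rV] := compact_thickening (@carrier_compact _ _ G) GV.
(* points within r of G lie in V, and e bounds the Hausdorff distance; W is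
   taken in the m / 2-neighbourhood of G so that its closure is still m-close *)
pose m := Num.min r e.
have m0 : 0 < m by rewrite lt_min r0.
have m20 : 0 < m / 2 by rewrite divr_gt0.
have m40 : 0 < m / 4 by rewrite divr_gt0.
have [|W [GW pW WV]] := sG [set y | exists2 g, carrier G g & mdist g y < m / 2].
  move=> g Gg; apply: filterS (nbhs_mdist_lt g m20) => y gy.
  by exists g.
exists W => // x L Wx [_ _ iL _] xL.
have LG y : carrier L y -> exists2 g, carrier G g & mdist g y < 3 * m / 4.
  move=> /xL/(_ _ (nbhs_mdist_lt y m40))[z [Oz /= yz]].
  have [g Gg gz] := WV _ (forward_orbit_sub pW Wx Oz).
  exists g => //; have := metric_triangle g z y; rewrite (metric_sym z y).
  by move: gz yz; lra.
have mr : m <= r by rewrite ge_min lexx.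
have me : m <= e by rewrite ge_min lexx orbT.
apply: (@le_lt_trans _ _ (3 * e / 4)); last by move: e0; lra.
apply: hausdorff_dist_le; split; first by move: e0; lra.
- move=> g Gg; have [y Ly] := carrier_nonempty L.
  have [h Gh hy] := LG y Ly.
  have [|t gt] := rV h y Gh _ g Gg; first by move: m0 mr hy; lra.
  exists (phi t y); first exact: iL.
  by move: e0 gt; lra.
- move=> y /LG[g Gg gy]; exists g => //.
  by move: me gy; lra.
Qed.

(** A point near x enters the trapping neighbourhood of G together with x. *)
Lemma attracted_continuous G x e :
  minimal_set phi G -> stable phi G -> attracted x G -> 0 < e ->
  \forall y \near x, forall L, minimal_set phi L -> attracted y L ->
    hausdorff_dist G L < e.
Proof.
move=> mG sG xG e0; have [W GW HW] := stable_attracted_near mG sG e0.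
have [t t0 Wt] := attracted_enters GW xG.
apply: filterS (nbhs_flow Wt) => y Wy L mL yL.
apply: (HW _ _ Wy mL); apply: attracted_flow => //.
by case: mL.
Qed.

Lemma attracted_unique G L x : minimal_set phi G -> stable phi G ->
  minimal_set phi L -> attracted x G -> attracted x L -> G = L.
Proof.
move=> mG sG mL xG xL; apply: hausdorff_dist_positivity; apply/eqP.
rewrite eq_le hausdorff_dist_ge0 andbT; apply/ler_addgt0Pl => e e0.
rewrite addr0 ltW//.
exact: (nbhs_singleton (attracted_continuous mG sG xG e0)).
Qed.

Lemma HS_minimal G : HS phi G -> minimal_set phi G.
Proof. by case. Qed.

(** Otherwise the neighbourhood of G free of unstable minimal sets would contain
    the unstable set G itself. *)
Lemma HS_stable G : HS phi G -> stable phi G.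
Proof.
move=> [mG [V GV Vu]]; apply: contrapT => nsG.
have [g Gg] := carrier_nonempty G.
have : (V `&` G) g by split => //; apply: interior_subset; exact: GV.
by rewrite (Vu G) //; split.
Qed.

Hypothesis lcM : locally_compact [set: M].

(** By stability, points near G stay in a compact set C inside the open set free
    of unstable minimal sets.  The minimal set found in their orbit closure lies
    in C, hence is hyper-stable with the same witness V. *)
Lemma HS_attracts_neighbourhood G : HS phi G ->
  exists2 W, neighbourhood G W & forall x, W x ->
    exists2 L, HS phi L & attracted x L.
Proof.
move=> HG; have [mG [V GV Vu]] := HG.
have [|C [GC cC clC CV]] := compact_neighbourhood lcM (@carrier_compact _ _ G) _
    (U := V°).
  by move=> y /GV /nbhs_interior.
have [W [GW pW WC]] := HS_stable HG GC.
exists W => // x Wx.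
have OC : closure (forward_orbit x) `<=` C.
  rewrite [X in _ `<=` X](closure_id C).1//; apply: closureS.
  by apply: subset_trans WC; exact: forward_orbit_sub.
have [|L [mL xL]] := @exists_minimal_attracted x.
  by apply: (subclosed_compact _ cC) => //; exact: closed_closure.
exists L => //; split=> //; exists V => //.
by move=> y /xL/OC/CV.
Qed.

Definition basin := [set x | exists2 G, HS phi G & attracted x G].

Lemma HS_sub_basin G : HS phi G -> G `<=` basin.
Proof.
move=> HG x Gx; exists G => //.
by apply: minimal_attracted => //; exact: HS_minimal.
Qed.

Lemma basin_open : open basin.
Proof.
rewrite openE => x [G HG xG].
have [W GW HW] := HS_attracts_neighbourhood HG.
have [t t0 Wt] := attracted_enters GW xG.
apply: filterS (nbhs_flow Wt) => y /HW[L HL yL].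
by exists L => //; exact: flow_attracted yL.
Qed.

(** The set G0 is the value of f outside the basin.  Continuity of f comes from
    [attracted_continuous].  For the last property: a set L in HS close to G has
    a point y close to x, and f y = L because y is in L. *)
Lemma exists_attractor_map (G0 : set_type (HS phi)) :
  exists f : M -> set_type (HS phi), [/\
    forall x, basin x -> {for x, continuous f},
    forall (G : set_type (HS phi)) x, carrier (val G) x -> f x = G
    & forall (G : set_type (HS phi)) x P, carrier (val G) x -> nbhs x P ->
        nbhs G (f @` P)].
Proof.
have /choice[f Hf] : forall x, exists G : set_type (HS phi),
    basin x -> attracted x (val G).
  move=> x; have [[G HG xG]|nx] := pselect (basin x); last by exists G0.
  by exists (SigSub (mem_set HG)).
have HSv (G : set_type (HS phi)) : HS phi (val G) by exact: set_valP.
have fG (G : set_type (HS phi)) x : carrier (val G) x -> f x = G.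
  move=> Gx; apply/esym/val_inj.
  have mG := HS_minimal (HSv G).
  apply: (attracted_unique mG (HS_stable (HSv G)) (HS_minimal (HSv _))
    (minimal_attracted mG Gx)).
  by apply: Hf; exact: (HS_sub_basin (HSv G)).
exists f; split => //.
- move=> x bx U /nbhs_mdistP[e e0 eU].
  have := attracted_continuous (HS_minimal (HSv (f x))) (HS_stable (HSv (f x)))
    (Hf _ bx) e0.
  have : nbhs x basin by apply: open_nbhs_nbhs; split => //; exact: basin_open.
  apply: filterS2 => y by_ /(_ _ (HS_minimal (HSv (f y))) (Hf _ by_)).
  exact: eU.
- move=> G x P Gx /nbhs_mdistP[e e0 eP]; apply/nbhs_mdistP; exists e => // L GL.
  have [r [_ /(_ _ Gx)[y Ly xy] _] re] := hausdorff_radii_lt GL.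
  exists y; first by apply: eP; exact: lt_trans re.
  exact: fG.
Qed.

End flow.

(** * Images under maps open at one preimage of each point *)

Section open_at_some_preimage.
Context {R : realType} {M : metricType R} {T : topologicalType}.
Variables (f : M -> T) (D : set M).
Hypothesis D_open : open D.
Hypothesis f_continuous : forall x, D x -> {for x, continuous f}.
(* the attractor map satisfies this at the points of the attractor; elsewhere in
   the basin it may fail *)
Hypothesis f_nbhs : forall t, exists x,
  [/\ D x, f x = t & forall P, nbhs x P -> nbhs t (f @` P)].

Let f_within A : A `<=` D -> {within A, continuous f}.
Proof.
move=> AD; apply: continuous_in_subspaceT => x /set_mem/AD.
exact: f_continuous.
Qed.

Lemma locally_connected_image : locally_connected M -> locally_connected T.
Proof.
move=> lcM; apply: im_kleinen_locally_connected => t U tU.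
have [x [Dx fx fP]] := f_nbhs t.
have [|V [oV Vx cV VU]] := lcM x (f @^-1` U `&` D).
  apply: filterI; last by apply: open_nbhs_nbhs.
  by apply: f_continuous => //; rewrite fx.
exists (f @` V); split.
- by apply: fP; exact: open_nbhs_nbhs.
- by apply: connected_continuous_connected => //; apply: f_within => y /VU[].
- by move=> _ [y /VU[Uy _] <-].
Qed.

Lemma locally_compact_image : hausdorff_space T ->
  locally_compact [set: M] -> locally_compact [set: T].
Proof.
move=> hT lkM; apply/locally_compactP => t.
have [x [Dx fx fP]] := f_nbhs t.
have xD : nbhs x D by exact: open_nbhs_nbhs.
have [C [xC cC _ CD]] := locally_compact_nbhs lkM xD.
have cfC : compact (f @` C) by apply: continuous_compact => //; exact: f_within.
by exists (f @` C); split; [exact: fP| |exact: compact_closed].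
Qed.

End open_at_some_preimage.

(** * The space of hyper-stable minimal sets *)

Theorem corollary3 (R : realType) (M : metricType R) (phi : R -> M -> M) :
  generalized_peano_continuum M -> C0_flow phi ->
  locally_peano_continuum (set_type (HS phi)) /\
  exists F : set (set (set_type (HS phi))),
    [/\ countable F,
        trivIset F id,
        \bigcup_(C in F) C = [set: set_type (HS phi)]
      & forall C, F C ->
          clopen C /\ generalized_peano_continuum (set_type C)].
Proof.
move=> [lkM cM lcM] flow_phi; pose T := set_type (HS phi).
have [[G0 _]|HS0] := pselect ([set: T] !=set0); last first.
  split=> [x|]; first by exfalso; apply: HS0; exists x.
  exists set0; split=> [|C E []| |C []]; first exact: countable0.
  rewrite bigcup_set0; apply/esym; rewrite -subset0 => x _.
  by apply: HS0; exists x.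
have [f [fcont fG fnbhs]] := exists_attractor_map flow_phi lkM G0.
have oB := basin_open flow_phi lkM.
have GB (G : T) x : carrier (val G) x -> basin phi x.
  by apply: (HS_sub_basin flow_phi); exact: set_valP.
have fsurj (G : T) : exists x,
    [/\ basin phi x, f x = G & forall P, nbhs x P -> nbhs G (f @` P)].
  have [x Gx] := carrier_nonempty (val G).
  by exists x; split; [exact: GB Gx|exact: fG|move=> P; exact: fnbhs].
have lkT : locally_compact [set: T].
  apply: (locally_compact_image oB fcont fsurj) => //.
  exact: metric_hausdorff.
have lcT : locally_connected T.
  exact: (locally_connected_image oB fcont fsurj).
split; first exact: locally_compact_connected_peano.
exists (range (connected_component [set: T])).
have Fcomp C (G : T) : range (connected_component [set: T]) C -> C G ->
    C = connected_component [set: T] G.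
  by move=> [L _ <-] LG; exact: same_connected_component.
split.
- apply: (@disjoint_open_countable _ _ _ _ (fun C => basin phi `&` f @^-1` C)).
  + exact: connected_countably_ball_covered.
  + move=> _ [G _ <-]; have [oG _] := clopen_component G lcT.
    split; last first.
      have [x [Bx fx _]] := fsurj G; exists x; split=> //=; rewrite fx.
      exact: connected_component_refl.
    rewrite openE => x [Bx fx]; apply: filterI; first exact: open_nbhs_nbhs.
    by apply: fcont => //; exact: open_nbhs_nbhs.
  + move=> C E FC FE [x [[_ Cx] [_ Ex]]].
    by rewrite (Fcomp C _ FC Cx) (Fcomp E _ FE Ex).
- move=> C E FC FE [G [CG EG]].
  by rewrite (Fcomp C _ FC CG) (Fcomp E _ FE EG).
- rewrite -subTset => G _; exists (connected_component [set: T] G) => //.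
  exact: connected_component_refl.
- move=> _ [G _ <-]; have clG := clopen_component G lcT; split=> //.
  apply: clopen_connected_generalized_peano => //.
  exact: component_connected.
Qed.
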